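(* Let $(\mathbf{B},\|\cdot\|_{\mathbf{B}})$ be a Banach space, and let $K=(\mathbf{B}^* )_1$ be the unit ball of the dual space of $\mathbf{B}$, given the weak$^*$-topology. Then there is a function $F:\mathbf{B}\to L(C(K))$ such that $F$ is a bounded $L(C(K))$-valued norm on $\mathbf{B}$ and, in particular, $\|F(b)\|=\|b\|_{\mathbf{B}}$ for every $b\in\mathbf{B}$.
   Context: All spaces are over $\mathbb{C}$. For a compact Hausdorff space $K$, $C(K)$ is the Banach space of continuous complex-valued functions on $K$ with the supremum norm, and $L(C(K))$ is the space of bounded linear operators on $C(K)$ with the operator norm. For $f\in C(K)$, $f\ge 0$ means that $f$ is real-valued and nonnegative at every point of $K$. The unit ball of the dual is the closed unit ball $\{\varphi\in\mathbf{B}^*:\|\varphi\|\le 1\}$, which is compact Hausdorff in the weak$^*$-topology. For a normed linear space $X$, a function $F:X\to L(C(K))$ is an $L(C(K))$-valued norm on $X$ if: (1) for every $x\in X$, $F(x)f\ge 0$ whenever $f\in C(K)$ and $f\ge 0$; (2) $(F(x)+F(y)-F(x+y))f\ge 0$ for all $x,y\in X$ and all $f\in C(K)$ with $f\ge 0$; (3) $F(\lambda x)=|\lambda|F(x)$ for all $\lambda\in\mathbb{C}$ and $x\in X$; (4) $F(x)=0$ if and only if $x=0$. It is bounded if $\sup_{\|x\|=1}\|F(x)\|<\infty$. *)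

(* Defs.v *)
From HB Require Import structures.
From mathcomp Require Import all_boot all_order all_algebra.
From mathcomp Require Import complex.
From mathcomp Require Import all_classical all_reals topology normedtype.

Set Implicit Arguments.
Unset Strict Implicit.
Unset Printing Implicit Defensive.

Import Order.TTheory GRing.Theory Num.Theory.
Import numFieldNormedType.Exports.

Local Open Scope classical_set_scope.
Local Open Scope complex_scope.
Local Open Scope ring_scope.

(* The norm of a complex normed module takes its values in [R[i]]; [rnorm] is
   the same quantity seen in [R], where suprema are available. *)
Definition rnorm (R : realType) (V : normedModType R[i]) (v : V) : R :=
  complex.Re `|v|.

Section rnorm_theory.
Context {R : realType} {V : normedModType R[i]}.
Implicit Types v w : V.

Lemma rnormE v : `|v| = (rnorm v)%:C.
Proof. by rewrite /rnorm RRe_real// normr_real. Qed.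

Lemma rnorm_ge0 v : 0 <= rnorm v.
Proof. by rewrite -lecR -rnormE normr_ge0. Qed.

Lemma rnormD v w : rnorm (v + w) <= rnorm v + rnorm w.
Proof. by rewrite -lecR rmorphD/= -!rnormE ler_normD. Qed.

Lemma rnormZ (a : R[i]) v : rnorm (a *: v) = rnorm (a : R[i]^o) * rnorm v.
Proof. by apply: complexI; rewrite rmorphM/= -!rnormE normrZ. Qed.

Lemma rnorm0 : rnorm (0 : V) = 0.
Proof. by apply: complexI; rewrite -rnormE normr0. Qed.

Lemma rnorm0_eq0 v : rnorm v = 0 -> v = 0.
Proof. by move=> v0; apply/normr0_eq0; rewrite rnormE v0. Qed.

Lemma rnorm_continuous : continuous (@rnorm R V).
Proof.
move=> v; apply/cvgrPdist_lt => e e0.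
have /cvgrPdist_lt/(_ e%:C) : w @[w --> v] --> v by [].
rewrite ltcR => /(_ e0); apply: filterS => w; rewrite rnormE ltcR.
apply: le_lt_trans; rewrite ler_norml lerNl opprB !lerBlDr; apply/andP; split.
  rewrite -{1}(subrK v w) (le_trans (rnormD _ _))// lerD2r.
  by rewrite -lecR -!rnormE distrC.
by rewrite -{1}(subrK w v) rnormD.
Qed.

End rnorm_theory.

Lemma homogeneousP (R : realType) (V : lmodType R[i]) (N : V -> R) :
  (forall v, 0 <= N v) ->
  (forall (a : R[i]) v, N (a *: v) <= rnorm (a : R[i]^o) * N v) ->
  forall (a : R[i]) v, (N (a *: v))%:C = `|a| * (N v)%:C.
Proof.
move=> N0 NZ a v.
have -> : `|a| = (rnorm (a : R[i]^o))%:C by rewrite -rnormE.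
rewrite -rmorphM/=; congr (_%:C); apply/eqP; rewrite eq_le NZ/=.
have [->|a0] := eqVneq a 0; first by rewrite (rnorm0 (V := R[i]^o)) mul0r.
have na0 : 0 < rnorm (a : R[i]^o).
  rewrite lt_neqAle rnorm_ge0 andbT eq_sym.
  by apply: contra_neq a0; exact: rnorm0_eq0.
have := NZ a^-1 (a *: v); rewrite scalerA mulVf// scale1r.
have -> : rnorm (a^-1 : R[i]^o) = (rnorm (a : R[i]^o))^-1.
  by apply: complexI; rewrite fmorphV/= -!rnormE normfV.
by rewrite ler_pdivlMl.
Qed.

Section bounded_linear_maps.
Context {R : realType}.
Variables V W : normedModType R[i].

Definition bounded_linear (f : V -> W) :=
  linear f /\ exists M : R, forall x, rnorm (f x) <= M * rnorm x.

Definition blinear : {pred V -> W} := [pred f | `[< bounded_linear f >]].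

Record blinMap := BLinMap { blin_fun :> V -> W ; _ : blin_fun \in blinear }.

HB.instance Definition _ := [isSub for blin_fun].
HB.instance Definition _ := [Choice of blinMap by <:].

Lemma blinMapP (f : blinMap) : bounded_linear f.
Proof. by have /asboolP := valP f. Qed.

Lemma blinMap_is_linear (f : blinMap) : linear f.
Proof. by case: (blinMapP f). Qed.

HB.instance Definition _ (f : blinMap) :=
  GRing.isLinear.Build R[i] V W *:%R f (blinMap_is_linear f).

Lemma blinear_submod_closed : submod_closed blinear.
Proof.
split=> [|a f g /asboolP[lf [M fM]] /asboolP[lg [N gN]]]; apply/asboolP.
  split=> [c x y|]; first by rewrite /= scaler0 addr0.
  by exists 0 => x; rewrite rnorm0 mul0r.
split=> [c x y|].
  by rewrite !fctE lf lg !scalerDr !scalerA addrACA [a * c]mulrC.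
exists (rnorm (a : R[i]^o) * M + N) => x.
rewrite (le_trans (rnormD _ _))// mulrDl lerD//.
by rewrite rnormZ -mulrA ler_wpM2l// rnorm_ge0.
Qed.

HB.instance Definition _ :=
  GRing.isSubmodClosed.Build _ _ blinear blinear_submod_closed.
HB.instance Definition _ := [SubChoice_isSubLmodule of blinMap by <:].

Definition opnorm (f : blinMap) : R :=
  sup [set rnorm (f x) | x in [set x | rnorm x <= 1]].

Lemma opnorm_has_sup (f : blinMap) :
  has_sup [set rnorm (f x) | x in [set x | rnorm x <= 1]].
Proof.
split; first by exists (rnorm (f 0)), 0 => //=; rewrite rnorm0.
have [_ [M fM]] := blinMapP f; exists `|M| => _ [x /= x1 <-].
rewrite (le_trans (fM x))// (le_trans (ler_wpM2r (rnorm_ge0 _) (ler_norm M)))//.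
by rewrite -[leRHS]mulr1 ler_wpM2l.
Qed.

Lemma opnorm_ge0 (f : blinMap) : 0 <= opnorm f.
Proof.
rewrite (le_trans (rnorm_ge0 (f 0)))//; apply: sup_upper_bound.
  exact: opnorm_has_sup.
by exists 0 => //=; rewrite rnorm0.
Qed.

Lemma opnormP (f : blinMap) x : rnorm (f x) <= opnorm f * rnorm x.
Proof.
have [->|x0] := eqVneq x 0; first by rewrite linear0 !rnorm0 mulr0.
have nx0 : 0 < rnorm x.
  rewrite lt_neqAle rnorm_ge0 andbT eq_sym.
  by apply: contra_neq x0; exact: rnorm0_eq0.
have nV : rnorm ((rnorm x)^-1%:C : R[i]^o) = (rnorm x)^-1.
  by apply: complexI; rewrite -rnormE ger0_norm// ler0c invr_ge0 ltW.
rewrite -ler_pdivrMr// mulrC -[X in X * _]nV -rnormZ -linearZ.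
apply: sup_upper_bound; first exact: opnorm_has_sup.
by eexists; last reflexivity; rewrite /= rnormZ nV mulVf// gt_eqF.
Qed.

Lemma opnorm_le (f : blinMap) (M : R) : 0 <= M ->
  (forall x, rnorm (f x) <= M * rnorm x) -> opnorm f <= M.
Proof.
move=> M0 fM; apply: ge_sup; first by case: (opnorm_has_sup f).
move=> _ [x /= x1 <-]; rewrite (le_trans (fM x))// -[leRHS]mulr1.
by rewrite ler_wpM2l.
Qed.

Let opnormC (f : blinMap) : R[i] := (opnorm f)%:C.

Let opnormCD f g : opnormC (f + g) <= opnormC f + opnormC g.
Proof.
rewrite /opnormC -rmorphD/= lecR; apply: opnorm_le => [|x].
  by rewrite addr_ge0// opnorm_ge0.
by rewrite (le_trans (rnormD _ _))// mulrDl lerD// opnormP.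
Qed.

Let opnormZ_le (a : R[i]) f : opnorm (a *: f) <= rnorm (a : R[i]^o) * opnorm f.
Proof.
apply: opnorm_le => [|x]; first by rewrite mulr_ge0// ?rnorm_ge0// opnorm_ge0.
by rewrite rnormZ -mulrA ler_wpM2l ?rnorm_ge0// opnormP.
Qed.

Let opnormCZ (a : R[i]) f : opnormC (a *: f) = `|a| * opnormC f.
Proof. exact: (homogeneousP opnorm_ge0 opnormZ_le). Qed.

Let opnormC0_eq0 f : opnormC f = 0 -> f = 0.
Proof.
move=> [f0]; apply/val_inj/funext => x /=; apply: rnorm0_eq0.
apply/eqP; rewrite eq_le rnorm_ge0 andbT.
by rewrite (le_trans (opnormP f x))// f0 mul0r.
Qed.

HB.instance Definition _ :=
  Lmodule_isNormed.Build R[i] blinMap opnormCD opnormCZ opnormC0_eq0.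

Lemma blinMap_normE (f : blinMap) :
  `|f| = (sup [set rnorm (f x) | x in [set x | rnorm x <= 1]])%:C.
Proof. by []. Qed.

End bounded_linear_maps.

Arguments blinear {R V W}.

HB.mixin Record isCompactHausdorff K & Topological K := {
  compact_setT : compact [set: K] ;
  hausdorff_setT : hausdorff_space K
}.

#[short(type="compactHausdorffType")]
HB.structure Definition CompactHausdorff :=
  {K of Topological K & isCompactHausdorff K}.

(* The library's [continuousType] carries the compact-open topology; C(K) is a
   separate type because it is equipped with the supremum norm. *)
Section continuous_functions.
Context {R : realType}.
Variable K : compactHausdorffType.

Definition continuous_pred : {pred K -> R[i]^o} :=
  [pred f | `[< continuous f >]].

Record contFun :=
  ContFun { cont_fun :> K -> R[i]^o ; _ : cont_fun \in continuous_pred }.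

HB.instance Definition _ := [isSub for cont_fun].
HB.instance Definition _ := [Choice of contFun by <:].

Lemma contFunP (f : contFun) : continuous f.
Proof. by have /asboolP := valP f. Qed.

Lemma continuous_submod_closed : submod_closed continuous_pred.
Proof.
split=> [|a f g /asboolP cf /asboolP cg]; apply/asboolP => x.
  exact: cst_continuous.
by apply: cvgD; [apply: cvgZl_tmp; exact: cf|exact: cg].
Qed.

HB.instance Definition _ :=
  GRing.isSubmodClosed.Build _ _ continuous_pred continuous_submod_closed.
HB.instance Definition _ := [SubChoice_isSubLmodule of contFun by <:].

Definition supnorm (f : contFun) : R := sup (range (fun k => rnorm (f k))).

Lemma supnorm_has_ubound (f : contFun) :
  has_ubound (range (fun k => rnorm (f k))).
Proof.
have cK : compact (range (fun k => rnorm (f k))).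
  apply: continuous_compact; last exact: compact_setT.
  apply: continuous_subspaceT => k.
  by apply: continuous_comp; [exact: contFunP|exact: rnorm_continuous].
have [M [_ fM]] := compact_bounded cK.
exists (M + 1) => r fr; apply: le_trans (ler_norm r) _.
by apply: fM fr; rewrite ltrDl.
Qed.

Lemma supnormP (f : contFun) k : rnorm (f k) <= supnorm f.
Proof. by apply: ub_le_sup; [exact: supnorm_has_ubound|exists k]. Qed.

Lemma supnorm_ge0 (f : contFun) : 0 <= supnorm f.
Proof.
rewrite /supnorm.
have [->|/set0P[_ [k _ _]]] := eqVneq (range (fun k => rnorm (f k))) set0.
  by rewrite sup0.
exact: le_trans (rnorm_ge0 (f k)) (supnormP f k).
Qed.

Lemma supnorm_le (f : contFun) (M : R) : 0 <= M ->
  (forall k, rnorm (f k) <= M) -> supnorm f <= M.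
Proof.
move=> M0 fM.
rewrite /supnorm.
have [->|/set0P r0] := eqVneq (range (fun k => rnorm (f k))) set0.
  by rewrite sup0.
by apply: ge_sup => // _ [k _ <-].
Qed.

Let supnormC (f : contFun) : R[i] := (supnorm f)%:C.

Let supnormCD f g : supnormC (f + g) <= supnormC f + supnormC g.
Proof.
rewrite /supnormC -rmorphD/= lecR; apply: supnorm_le => [|k].
  by rewrite addr_ge0// supnorm_ge0.
by rewrite (le_trans (rnormD _ _))// lerD// supnormP.
Qed.

Let supnormZ_le (a : R[i]) f :
  supnorm (a *: f) <= rnorm (a : R[i]^o) * supnorm f.
Proof.
apply: supnorm_le => [|k]; first by rewrite mulr_ge0// ?rnorm_ge0// supnorm_ge0.
by rewrite rnormZ ler_wpM2l ?rnorm_ge0// supnormP.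
Qed.

Let supnormCZ (a : R[i]) f : supnormC (a *: f) = `|a| * supnormC f.
Proof. exact: (homogeneousP supnorm_ge0 supnormZ_le). Qed.

Let supnormC0_eq0 f : supnormC f = 0 -> f = 0.
Proof.
move=> [f0]; apply/val_inj/funext => k /=; apply: rnorm0_eq0.
apply/eqP; rewrite eq_le rnorm_ge0 andbT.
by rewrite (le_trans (supnormP f k))// f0.
Qed.

HB.instance Definition _ :=
  Lmodule_isNormed.Build R[i] contFun supnormCD supnormCZ supnormC0_eq0.

Lemma contFun_normE (f : contFun) :
  `|f| = (sup (range (fun k => rnorm (f k))))%:C.
Proof. by []. Qed.

End continuous_functions.

Arguments contFun R K : clear implicits.
Arguments continuous_pred {R K}.

Section dual_ball.
Context {R : realType}.
Variable B : normedModType R[i].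

Definition dual := blinMap B R[i]^o.

Definition dual_ball := {phi : dual | `|phi| <= 1}.

(* The weak* topology on the dual, hence on its unit ball, is the initial
   topology for the evaluations at the points of B. *)
Definition dual_ball_eval (phi : dual_ball) : {ptws B -> R[i]^o} :=
  fun x => val phi x.

HB.instance Definition _ := Choice.on dual_ball.
HB.instance Definition _ :=
  Topological.copy dual_ball (initial_topology dual_ball_eval).

Lemma dual_ball_eval_inj : injective dual_ball_eval.
Proof. by move=> phi psi e; apply/val_inj/val_inj. Qed.

Lemma dual_ball_eval_continuous : continuous dual_ball_eval.
Proof. exact: initial_continuous. Qed.

Let evalx_continuous (x : B) :
  continuous (fun f : {ptws B -> R[i]^o} => f x).
Proof. exact: (@proj_continuous _ (fun=> R[i]^o) x). Qed.

Let box (r : R) : set R[i]^o :=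
  (fun z : R * R => z.1 +i* z.2) @` (`[- r, r] `*` `[- r, r]).

Let box_compact r : compact (box r).
Proof.
apply: continuous_compact; last first.
  by apply: compact_setX; exact: segment_compact.
apply: continuous_subspaceT => z.
have C_cont : continuous (fun a : R => a%:C : R[i]^o).
  move=> a; apply/cvgrPdist_lt => e e0.
  have eE : (complex.Re e)%:C = e by rewrite RRe_real// gtr0_real.
  have /cvgrPdist_lt/(_ (complex.Re e)) : b @[b --> a] --> a by [].
  rewrite -ltcR eE => /(_ e0); apply: filterS => b ab.
  by rewrite -rmorphB/= normc_def/= expr0n addr0 sqrtr_sqr -eE ltcR.
have -> : (fun z : R * R => z.1 +i* z.2 : R[i]^o) =
    (fun z : R * R => (z.1)%:C + ('i%C : R[i]) *: ((z.2)%:C : R[i]^o)).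
  apply/funext => -[a b]; rewrite [LHS]complexE/=.
  by [].
apply: cvgD.
  by apply: continuous_comp; [exact: cvg_fst|exact: C_cont].
apply: cvgZl_tmp; apply: (@continuous_comp _ _ _ snd (fun a : R => a%:C : R[i]^o)).
  exact: cvg_snd.
exact: C_cont.
Qed.

Let sub_box (z : R[i]^o) r : rnorm z <= r -> box r z.
Proof.
move=> zr; exists (complex.Re z, complex.Im z); last by case: z {zr}.
have Rez : `|complex.Re z| <= rnorm z by rewrite -lecR -rnormE normc_ge_Re.
have Imz : `|complex.Im z| <= rnorm z.
  rewrite -lecR -rnormE [leRHS]normc_def lecR -sqrtr_sqr ler_wsqrtr//.
  by rewrite lerDr sqr_ge0.
by split => /=; rewrite in_itv/= -ler_norml (le_trans _ zr).
Qed.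

Let range_eval : range dual_ball_eval =
  [set f | (forall a x y, f (a *: x + y) = a *: f x + f y) /\
           (forall x, rnorm (f x : R[i]^o) <= rnorm x)].
Proof.
apply/seteqP; split => [_ [phi _ <-]|f [lf fb]].
  split=> [a x y|x]; first by rewrite /dual_ball_eval linearP.
  rewrite (le_trans (opnormP _ _))// -[leRHS]mul1r ler_wpM2r ?rnorm_ge0//.
  by rewrite -lecR; exact: (valP phi).
have bf : f \in (blinear : {pred B -> R[i]^o}).
  by apply/asboolP; split=> //; exists 1 => x; rewrite mul1r.
have nf : `|BLinMap bf : dual| <= 1.
  rewrite [leLHS]/(_%:C) lecR; apply: opnorm_le => // x.
  by rewrite mul1r; exact: fb.
by exists (exist _ (BLinMap bf) nf).
Qed.

Let range_eval_compact : compact (range dual_ball_eval).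
Proof.
pose box_B : set {ptws B -> R[i]^o} := [set f | forall x, box (rnorm x) (f x)].
apply: (@subclosed_compact _ _ box_B).
- rewrite range_eval.
  have -> : [set f : {ptws B -> R[i]^o} |
      (forall a x y, f (a *: x + y) = a *: f x + f y) /\
      (forall x, rnorm (f x : R[i]^o) <= rnorm x)] =
    \bigcap_(p : R[i] * B * B)
      (fun f => f (p.1.1 *: p.1.2 + p.2) - (p.1.1 *: f p.1.2 + f p.2))
        @^-1` [set 0] `&`
    \bigcap_x (fun f => rnorm (f x : R[i]^o)) @^-1` [set r | r <= rnorm x].
    apply/seteqP; split => f [f1 f2].
      by split => [p _|x _] /=; [rewrite f1 subrr|exact: f2].
    split => [a x y|x]; last exact: f2.
    by apply/eqP; rewrite -subr_eq0; apply/eqP; exact: (f1 (a, x, y)).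
  apply: closedI; apply: closed_bigI => p _; apply: preimage_closed.
  + move=> f _.
    have ev x := @evalx_continuous x f.
    exact: cvgB (ev _) (cvgD (cvgZl_tmp (k := p.1.1) (ev p.1.2)) (ev _)).
  + exact/accessible_closed_set1/hausdorff_accessible/norm_hausdorff.
  + move=> f _; apply: continuous_comp; first exact: evalx_continuous.
    exact: rnorm_continuous.
  + exact: closed_le.
- exact: (@tychonoff B (fun=> R[i]^o) (fun x => box (rnorm x))).
- by rewrite range_eval => f [_ fb] x; exact: sub_box.
Qed.

Let dual_ball_compact : compact [set: dual_ball].
Proof.
move=> F FF _.
have FT : (dual_ball_eval @ F) (range dual_ball_eval).
  apply: (@filterS _ F _ setT); last exact: filterT.
  by move=> phi _; exists phi.
have [_ [[phi _ <-] cl]] :=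
  range_eval_compact (fmap_proper_filter dual_ball_eval FF) FT.
exists phi; split => // A U FA.
rewrite nbhsE => -[V [[W oW <-] Wphi] VU].
have [||_ [[psi Apsi <-] Wpsi]] := cl (dual_ball_eval @` A) W.
- by apply: (@filterS _ F _ A) FA => psi; exists psi.
- exact: open_nbhs_nbhs.
by exists psi; split => //; exact: VU.
Qed.

Let dual_ball_hausdorff : hausdorff_space dual_ball.
Proof.
move=> phi psi cl; apply: dual_ball_eval_inj.
have hp : hausdorff_space {ptws B -> R[i]^o}.
  by apply: hausdorff_product => _; exact: norm_hausdorff.
apply: hp => U V Uphi Vpsi.
have [|| chi [Uchi Vchi]] := cl (dual_ball_eval @^-1` U) (dual_ball_eval @^-1` V).
- exact: dual_ball_eval_continuous.
- exact: dual_ball_eval_continuous.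
by exists (dual_ball_eval chi).
Qed.

HB.instance Definition _ :=
  isCompactHausdorff.Build dual_ball dual_ball_compact dual_ball_hausdorff.

End dual_ball.

Section operator_valued_norms.
Context {R : realType} {K : compactHausdorffType}.

(* On R[i], [0 <= z] means that z is real and nonnegative. *)
Definition cont_nonneg (f : contFun R K) := forall k, 0 <= (f k : R[i]).

Definition opL := blinMap (contFun R K) (contFun R K).

Variable X : normedModType R[i].

Record operator_valued_norm (F : X -> opL) : Prop := {
  opv_ge0 : forall x f, cont_nonneg f -> cont_nonneg (F x f) ;
  opv_triangle : forall x y f,
    cont_nonneg f -> cont_nonneg ((F x + F y - F (x + y)) f) ;
  opv_homogeneous : forall (a : R[i]) x, F (a *: x) = `|a| *: F x ;
  opv_eq0 : forall x, F x = 0 <-> x = 0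
}.

Definition bounded_on_sphere (F : X -> opL) :=
  exists M : R, forall x, `|x| = 1 -> `|F x| <= M%:C.

End operator_valued_norms.

Arguments opL R K : clear implicits.

(* Main.v *)
(* F(b) is multiplication by the continuous function phi |-> |phi(b)| on the dual
   ball; the norm axioms hold pointwise in phi. The norm of F(b) is the maximum of
   |phi(b)| over the ball, which is |b| by the Hahn-Banach theorem.

   Hahn-Banach is obtained by minimizing sublinear functionals rather than by
   extending partial ones: below every sublinear functional there is, by Zorn, a
   minimal one, and a minimal sublinear functional q is linear because
   inf over t >= 0 of q(x + t a) - t q(a) is again sublinear and below q. *)
Require Import Defs.
From HB Require Import structures.
From mathcomp Require Import all_boot all_order all_algebra.
From mathcomp Require Import complex.
From mathcomp Require Import all_classical all_reals topology normedtype.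
From mathcomp Require Import ring.

Set Implicit Arguments.
Unset Strict Implicit.
Unset Printing Implicit Defensive.

Import Order.TTheory GRing.Theory Num.Theory.
Import numFieldNormedType.Exports.

Local Open Scope classical_set_scope.
Local Open Scope complex_scope.
Local Open Scope ring_scope.

(** * Minimal sublinear functionals and the real Hahn-Banach theorem *)

Section sublinear_functionals.
Context {R : realType} {V : lmodType R}.
Implicit Types (p q : V -> R) (x y a : V) (t : R).

(* The inequality in the second clause is an equality, by [sublinearZ]. *)
Definition sublinear p :=
  (forall x y, p (x + y) <= p x + p y) /\
  (forall t x, 0 <= t -> p (t *: x) <= t * p x).

Lemma sublinear0 p : sublinear p -> p 0 = 0.
Proof.
move=> [pD pZ]; apply/eqP; rewrite eq_le; apply/andP; split.
  by have := pZ 0 0 (lexx 0); rewrite scale0r mul0r.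
by have := pD 0 0; rewrite addr0 -subr_ge0 addrK.
Qed.

Lemma sublinearZ p t x : sublinear p -> 0 <= t -> p (t *: x) = t * p x.
Proof.
move=> sp; have [_ pZ] := sp.
rewrite le_eqVlt => /predU1P[<-|t0].
  by rewrite scale0r mul0r sublinear0.
apply/eqP; rewrite eq_le (pZ _ _ (ltW t0))/= -ler_pdivlMl//.
rewrite -[in leLHS](scale1r x) -(mulVf (lt0r_neq0 t0)) -scalerA.
by rewrite pZ// invr_ge0 ltW.
Qed.

Lemma sublinear_ge p x : sublinear p -> - p (- x) <= p x.
Proof.
move=> sp; rewrite lerNl -subr_ge0 opprK.
by have [/(_ (- x) x) + _] := sp; rewrite addNr sublinear0.
Qed.

(** Used for the shears of one functional and for chains in Zorn's lemma. An infimum is subadditive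
    once a single member of the family can serve two given members at their respective arguments. *)
Lemma sublinear_inf (F : set (V -> R)) : F !=set0 ->
  (forall x, has_lbound [set q x | q in F]) ->
  (forall q q' x y, F q -> F q' ->
    exists2 r, F r & r (x + y) <= q x + q' y) ->
  (forall q t x, F q -> 0 <= t -> exists2 r, F r & r (t *: x) <= t * q x) ->
  sublinear (fun x => inf [set q x | q in F]).
Proof.
move=> [q0 Fq0] lbF FD FZ.
have F0 x : [set q x | q in F] !=set0 by exists (q0 x), q0.
have infle q x : F q -> inf [set q x | q in F] <= q x.
  by move=> Fq; apply: ge_inf => //; exists q.
split=> [x y|t x].
  rewrite -lerBlDr; apply: lb_le_inf => // _ [q Fq <-].
  rewrite lerBlDr [leRHS]addrC -lerBlDr; apply: lb_le_inf => // _ [q' Fq' <-].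
  have [r Fr ler] := FD q q' x y Fq Fq'.
  by rewrite lerBlDl (le_trans (infle _ _ Fr)).
rewrite le_eqVlt => /predU1P[<-|t0].
  (* Division by [t] is impossible here; some member is already at most [0] at [0 *: x]. *)
  by have [r Fr +] := FZ _ 0 x Fq0 (lexx 0); rewrite !mul0r; apply/le_trans/infle.
rewrite -ler_pdivrMl//; apply: lb_le_inf => // _ [q Fq <-].
have [r Fr ler] := FZ _ t x Fq (ltW t0).
by rewrite ler_pdivrMl// (le_trans (infle _ _ Fr)).
Qed.

Definition shear_family p a : set (V -> R) :=
  [set (fun x => p (x + t *: a) - t * p a) | t in [set t | 0 <= t]].

Definition shear p a x : R := inf [set q x | q in shear_family p a].

(** Subadditivity on [t *: a = (x + t *: a) + (- x)] gives the bound [- p (- x)], uniform in [t]. *)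
Lemma shear_lbound p a x : sublinear p ->
  has_lbound [set q x | q in shear_family p a].
Proof.
move=> sp; exists (- p (- x)) => _ [_ [t /= t0 <-] <-].
rewrite -(sublinearZ a sp t0) lerBrDr addrC lerBlDr.
have [/(_ (x + t *: a) (- x)) + _] := sp.
by rewrite addrAC subrr add0r.
Qed.

Lemma shear_le p a x t : sublinear p -> 0 <= t ->
  shear p a x <= p (x + t *: a) - t * p a.
Proof.
move=> sp t0; apply: ge_inf; first exact: shear_lbound.
by exists (fun y => p (y + t *: a) - t * p a) => //; exists t.
Qed.

Lemma shear_le_self p a x : sublinear p -> shear p a x <= p x.
Proof.
move=> sp; have := shear_le a x sp (lexx 0).
by rewrite scale0r mul0r addr0 subr0.
Qed.

(** Shear parameters follow their arguments: [s] and [t] combine to [s + t] under a sum, and [s]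
    becomes [t * s] under scaling by [t]. *)
Lemma sublinear_shear p a : sublinear p -> sublinear (shear p a).
Proof.
move=> sp; have [pD pZ] := sp; apply: sublinear_inf.
- by exists (fun y => p (y + 0 *: a) - 0 * p a), 0 => /=.
- by move=> x; exact: shear_lbound.
- move=> _ _ x y [s /= s0 <-] [t /= t0 <-].
  exists (fun y => p (y + (s + t) *: a) - (s + t) * p a).
    by exists (s + t) => //; exact: addr_ge0.
  rewrite /= scalerDl mulrDl opprD addrACA [leRHS]addrACA.
  by rewrite lerD2r pD.
- move=> _ t x [s /= s0 <-] t0.
  exists (fun y => p (y + (t * s) *: a) - (t * s) * p a).
    by exists (t * s) => //; exact: mulr_ge0.
  by rewrite /= -scalerA -scalerDr mulrBr mulrA lerD2r pZ.
Qed.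

Definition dominated p := [set q | sublinear q /\ forall x, q x <= p x].

Lemma exists_minimal_sublinear p : sublinear p ->
  exists2 q, dominated p q & forall r, dominated q r -> r = q.
Proof.
move=> sp.
(* The order is reversed, so that a maximal element for Zorn is a minimal functional. *)
pose le_rev (q r : {q | dominated p q}) :=
  `[< forall x, sval r x <= sval q x >].
have [|||A Atot|[q pq] qmin] := @Zorn {q | dominated p q} le_rev.
- by move=> q; apply/asboolP.
- move=> q r s /asboolP qr /asboolP rs; apply/asboolP => x.
  exact: le_trans (qr x).
- move=> [q pq] [r pr] /asboolP/= qr /asboolP/= rq; apply/eq_exist/funext => x.
  by apply/eqP; rewrite eq_le qr rq.
- have [->|/set0P[q Aq]] := eqVneq A set0.
    by exists (exist _ p (conj sp (fun=> lexx _))).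
  pose F := [set sval q | q in A].
  have lbF x : has_lbound [set q x | q in F].
    (* Each member satisfies [- p (- x) <= - r (- x) <= r x]. *)
    exists (- p (- x)) => _ [_ [r _ <-] <-]; have [sr rp] := svalP r.
    by rewrite (le_trans _ (sublinear_ge x sr))// lerN2.
  have sF : sublinear (fun x => inf [set q x | q in F]).
    apply: sublinear_inf => //; first by exists (sval q), q.
      move=> _ _ x y [r Ar <-] [s As <-].
      have [[rD _] _] := svalP r; have [[sD _] _] := svalP s.
      (* In a chain, the smaller of the two functionals serves both arguments. *)
      have [/asboolP rs|/asboolP sr] := Atot _ _ Ar As.
        by exists (sval s); [exists s|rewrite (le_trans (sD _ _))// lerD2r].
      by exists (sval r); [exists r|rewrite (le_trans (rD _ _))// lerD2l].
    move=> _ t x [r Ar <-] t0; exists (sval r); first by exists r.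
    by have [[_ rZ] _] := svalP r; exact: rZ.
  have infle r x : A r -> inf [set q x | q in F] <= sval r x.
    by move=> Ar; apply: ge_inf => //; exists (sval r) => //; exists r.
  have dF : dominated p (fun x => inf [set q x | q in F]).
    split=> // x; have [_ qp] := svalP q.
    exact: le_trans (infle _ _ Aq) (qp x).
  by exists (exist _ _ dF) => r Ar; apply/asboolP => x; exact: infle.
- exists q => // r [sr rq].
  have pr : dominated p r.
    by split=> // x; have [_ qp] := pq; exact: le_trans (qp x).
  have /(congr1 sval)// : exist _ r pr = exist _ q pq.
  by apply: qmin; apply/asboolP.
Qed.

(* The shears of a minimal functional [q] lie below it, hence equal [q], and at
   parameter [t = 1] this is superadditivity. *)
Lemma minimal_sublinear_scalar q : sublinear q ->
  (forall r, dominated q r -> r = q) -> scalar q.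
Proof.
move=> sq qmin.
have qD x y : q (x + y) = q x + q y.
  have [qD _] := sq; apply/eqP; rewrite eq_le qD/= -lerBrDr.
  have shear_q : shear q y = q.
    apply: qmin; split; first exact: sublinear_shear.
    by move=> z; exact: shear_le_self.
  by have := shear_le y x sq ler01; rewrite shear_q scale1r mul1r.
have qN x : q (- x) = - q x.
  by apply/eqP; rewrite -subr_eq0 opprK -qD addNr sublinear0.
move=> t x y; rewrite qD; congr (_ + _).
have [t0|/ltW t0] := leP 0 t; first exact: sublinearZ.
rewrite -[t in LHS]opprK scaleNr qN sublinearZ ?oppr_ge0//.
by rewrite mulNr opprK.
Qed.

(* Starting the minimization from [shear p a], whose value at [- a] is at most
   [- p a], forces [p a <= f a]. *)
Lemma hahn_banach p a : sublinear p ->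
  exists f : V -> R, [/\ scalar f, forall x, f x <= p x & f a = p a].
Proof.
move=> sp.
have [f [sf fp] fmin] := exists_minimal_sublinear (sublinear_shear a sp).
have lf := minimal_sublinear_scalar sf fmin.
exists f; split => // [x|]; first exact: le_trans (fp x) (shear_le_self a x sp).
apply/eqP; rewrite eq_le (le_trans (fp a) (shear_le_self a a sp))/=.
have := lf (-1) a 0; rewrite scaleN1r addr0 (sublinear0 sf) addr0 mulN1r => fN.
rewrite -lerN2 -fN (le_trans (fp _))// (le_trans (shear_le a _ sp ler01))//.
by rewrite scale1r addNr mul1r sublinear0// sub0r.
Qed.

End sublinear_functionals.

(** * Restriction of scalars from complex to real *)

Section realification.
Context {R : realType}.

(** An alias, so that the real module structure stays apart from the complex one on [V]. *)
Definition realified (V : lmodType R[i]) : Type := V.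

Variable V : lmodType R[i].

HB.instance Definition _ := GRing.Zmodule.on (realified V).

Let scale_real (t : R) (x : realified V) : realified V := t%:C *: (x : V).

Let scale_realA s t x : scale_real s (scale_real t x) = scale_real (s * t) x.
Proof. by rewrite /scale_real scalerA -rmorphM. Qed.

Let scale_real1 : left_id 1 scale_real.
Proof. by move=> x; rewrite /scale_real rmorph1 scale1r. Qed.

Let scale_realDr : right_distributive scale_real +%R.
Proof. by move=> t x y; rewrite /scale_real -scalerDr. Qed.

Let scale_realDl x : {morph scale_real^~ x : s t / s + t}.
Proof. by move=> s t; rewrite /scale_real rmorphD -scalerDl. Qed.

HB.instance Definition _ := GRing.Zmodule_isLmodule.Build R (realified V)
  scale_realA scale_real1 scale_realDr scale_realDl.

Lemma realified_scaleE (t : R) (x : V) : t *: (x : realified V) = t%:C *: x.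
Proof. by []. Qed.

End realification.

(** * Complex functionals in the dual ball that attain the norm at a given point *)

Section norming_functionals.
Context {R : realType} {B : normedModType R[i]}.
Implicit Types x b : B.

Lemma sublinear_rnorm : sublinear (@rnorm R B : realified B -> R).
Proof.
split=> [x y|t x t0]; first exact: rnormD.
rewrite realified_scaleE rnormZ.
suff -> : rnorm (t%:C : R[i]^o) = t by [].
by apply: complexI; rewrite -rnormE ger0_norm// ler0c.
Qed.

(* The imaginary part is forced by [phi ('i *: x) = 'i * phi x]. *)
Definition complexify (f : B -> R) x : R[i]^o := f x +i* - f ('i%C *: x).

Lemma complexify_linear (f : realified B -> R) :
  scalar f -> linear (complexify f).
Proof.
move=> lf.
have fD x y : f (x + y) = f x + f y.
  by have := lf 1 x y; rewrite scale1r mul1r.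
have f0 : f 0 = 0 by apply: (addrI (f 0)); rewrite -fD !addr0.
have fZ t x : f (t%:C *: x) = t * f x.
  by have := lf t x 0; rewrite f0 !addr0 realified_scaleE.
have fN x : f (- x) = - f x.
  by apply/eqP; rewrite -subr_eq0 opprK -fD addNr f0.
(* Both coordinates of [complexify f] at a complex multiple of [x] reduce to the values of [f] at
   [x] and ['i%C *: x]. *)
have fC (s t : R) x : f ((s +i* t) *: x) = s * f x + t * f ('i%C *: x).
  have -> : s +i* t = s%:C + t%:C * 'i%C by simpc.
  by rewrite scalerDl -scalerA fD !fZ.
move=> [s t] x y; rewrite /complexify scalerDr !fD scalerA.
have -> : 'i%C * (s +i* t) = (- t) +i* s :> R[i] by simpc.
rewrite (fC s t) (fC (- t) s); apply/eqP; rewrite eq_complex /=.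
by apply/andP; split; apply/eqP; rewrite ?opprD ?mulrN ?mulNr ?opprK; ring.
Qed.

Lemma complexify_le (f : realified B -> R) : scalar f ->
  (forall x, f x <= rnorm x) -> forall x, rnorm (complexify f x) <= rnorm x.
Proof.
move=> lf fle x; set z := complexify f x.
have [->|z0] := eqVneq z 0; first by rewrite rnorm0 rnorm_ge0.
have nz : rnorm z != 0 by apply: contra_neq z0; exact: rnorm0_eq0.
(* A rotation of [x] makes the value of the functional real. *)
pose theta : R[i] := (rnorm z)%:C / z.
have ntheta : rnorm (theta : R[i]^o) = 1.
  apply: complexI; rewrite -rnormE normrM normfV rnormE -rnormE normr_id.
  by rewrite mulfV// normr_eq0.
have <- : f (theta *: x) = rnorm z.
  rewrite -[LHS]/(complex.Re (complexify f (theta *: x))).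
  pose phi : {linear B -> R[i]^o} := HB.pack (complexify f)
    (GRing.isLinear.Build _ _ _ _ _ (complexify_linear lf)).
  by rewrite -[complexify f]/(phi : B -> _) linearZ_LR [_ *: _]divfK.
by rewrite (le_trans (fle _))// rnormZ ntheta mul1r.
Qed.

(** Real Hahn-Banach below the norm, tight at [b], followed by complexification, which preserves the
    bound by the norm. *)
Lemma exists_norming_functional b :
  exists phi : dual_ball B, rnorm (val phi b : R[i]^o) = rnorm b.
Proof.
have [f [lf fle fb]] := hahn_banach (b : realified B) sublinear_rnorm.
have bphi : complexify f \in (blinear : {pred B -> R[i]^o}).
  apply/asboolP; split; first exact: complexify_linear.
  by exists 1 => x; rewrite mul1r complexify_le.
have nphi : `|BLinMap bphi : dual B| <= 1.
  rewrite [leLHS]/(_%:C) lecR; apply: opnorm_le => // x.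
  by rewrite mul1r; exact: complexify_le.
exists (exist _ (BLinMap bphi) nphi); apply/eqP; rewrite eq_le.
apply/andP; split; first exact: complexify_le.
(* The real part of [complexify f b] is [f b], which already equals [rnorm b]. *)
rewrite -fb -lecR -rnormE; apply: le_trans (normc_ge_Re _).
by rewrite lecR ler_norm.
Qed.

End norming_functionals.

(** * Multiplication by the modulus of evaluation on the dual ball *)

Section multiplication_operator.
Context {R : realType} {B : normedModType R[i]}.
Implicit Types (b : B) (f : contFun R (dual_ball B)) (phi : dual_ball B).

(** Evaluation at [b] is the embedding into the product space followed by a coordinate
    projection. *)
Lemma evaluation_continuous b :
  continuous (fun phi => val phi b : R[i]^o).
Proof.
move=> phi; apply: (@continuous_comp _ _ _ (@dual_ball_eval R B)
  (fun f : {ptws B -> R[i]^o} => f b)).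
  exact: dual_ball_eval_continuous.
exact: (@proj_continuous _ (fun=> R[i]^o) b).
Qed.

Lemma dual_ball_rnorm_le phi b : rnorm (val phi b : R[i]^o) <= rnorm b.
Proof.
rewrite (le_trans (opnormP _ _))// -[leRHS]mul1r ler_wpM2r ?rnorm_ge0//.
by rewrite -lecR; exact: (valP phi).
Qed.

Lemma mult_fun_continuous b f :
  (fun phi => `|val phi b| * f phi) \in continuous_pred.
Proof.
apply/asboolP => phi; apply: (@cvgZ _ R[i]^o _ _ (nbhs_filter phi)).
  by apply: (@cvg_norm _ R[i]^o); exact: evaluation_continuous.
exact: contFunP.
Qed.

Definition mult_fun b f : contFun R (dual_ball B) :=
  ContFun (mult_fun_continuous b f).

Lemma mult_fun_le b f : rnorm (mult_fun b f) <= rnorm b * rnorm f.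
Proof.
apply: supnorm_le => [|phi]; first by rewrite mulr_ge0 ?rnorm_ge0.
rewrite /= -[_ * f phi]/(_ *: (f phi : R[i]^o)) rnormZ.
apply: ler_pM; rewrite ?rnorm_ge0//; last exact: supnormP.
rewrite (le_trans _ (dual_ball_rnorm_le phi b))//.
by rewrite -lecR -!rnormE normr_id.
Qed.

Lemma mult_fun_blinear b : mult_fun b \in blinear.
Proof.
apply/asboolP; split; last by exists (rnorm b); exact: mult_fun_le.
move=> a f g; apply/val_inj/funext => phi /=.
by rewrite !fctE mulrDr /GRing.scale/= mulrCA.
Qed.

Definition mult_op b : opL R (dual_ball B) := BLinMap (mult_fun_blinear b).

Lemma cst1_continuous : (cst 1 : dual_ball B -> R[i]^o) \in continuous_pred.
Proof. by apply/asboolP => phi; exact: cst_continuous. Qed.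

(** The upper bound is [mult_fun_le]; the constant function [1], evaluated at a norming functional
    for [b], shows that it is reached. *)
Lemma norm_mult_op b : `|mult_op b| = `|b|.
Proof.
rewrite rnormE [LHS]/(_%:C); congr (_%:C); apply/eqP; rewrite eq_le.
apply/andP; split; first by apply: opnorm_le; [exact: rnorm_ge0|exact: mult_fun_le].
have [phi <-] := exists_norming_functional b.
pose one := ContFun cst1_continuous.
have one1 : rnorm one <= 1.
  by apply: supnorm_le => // psi; rewrite -lecR -rnormE normr1.
rewrite -[leRHS]mulr1 (le_trans _ (ler_wpM2l (opnorm_ge0 _) one1))//.
rewrite (le_trans _ (opnormP _ _))// (le_trans _ (supnormP _ phi))//=.
by rewrite mulr1 -lecR -!rnormE normr_id.
Qed.

End multiplication_operator.

Theorem theorem2p8 (R : realType) (B : completeNormedModType R[i]) :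
  exists F : B -> opL R (dual_ball B),
    [/\ operator_valued_norm F,
        bounded_on_sphere F &
        forall b : B, `|F b| = `|b|].
Proof.
exists mult_op; split; [split|..].
- by move=> b f f0 phi; rewrite mulr_ge0.
- move=> x y f f0 phi /=.
  (* At [phi] the defect is [f phi] times the defect in the triangle inequality for [phi x] and
     [phi y]. *)
  rewrite -mulrDl -mulrBl mulr_ge0// subr_ge0.
  by rewrite linearD ler_normD.
- move=> a x; apply/val_inj/funext => f; apply/val_inj/funext => phi /=.
  by rewrite linearZ normrZ -mulrA.
(* Definiteness transfers through the equality of norms. *)
- move=> x; split=> x0; apply/normr0_eq0.
    by rewrite -norm_mult_op x0 normr0.
  by rewrite norm_mult_op x0 normr0.
- by exists 1 => x x1; rewrite norm_mult_op x1.
- exact: norm_mult_op.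
Qed.
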